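(* Let $\mathbf{C}$ be a 2-category and let $C,C',C''$ be pseudo-categories in $\mathbf{C}$. Let $F=(F_0,F_1,\mu^F,\varepsilon^F):C\to C'$ and $G=(G_0,G_1,\mu^G,\varepsilon^G):C'\to C''$ be pseudo-functors. Then the system $$GF=\Big(G_0F_0,\;G_1F_1,\;\big(\mu^G\circ(F_1\times_{F_0}F_1)\big)\cdot\big(G_1\circ\mu^F\big),\;\big(\varepsilon^G\circ F_0\big)\cdot\big(G_1\circ\varepsilon^F\big)\Big)$$ is a pseudo-functor from $C$ to $C''$ (that is, this formula for the composition of pseudo-functors is well defined).
   Context: Conventions. In a 2-category $\mathbf{C}$, $\circ$ (or juxtaposition) denotes composition of morphisms, horizontal composition of 2-cells and whiskering; $\cdot$ denotes vertical composition of 2-cells ($\beta\cdot\alpha$ means first $\alpha$, then $\beta$). All pullbacks mentioned are assumed to exist and are strict pullbacks in the 2-categorical sense (universal also for 2-cells), so that $\langle -,-\rangle$ denotes the induced morphism or 2-cell into a pullback. For $d,c:C_1\to C_0$, the pullback $C_1\times_{C_0}C_1$ has projections $\pi_1,\pi_2$ with $d\pi_1=c\pi_2$; similarly for triple and quadruple pullbacks. We write $f\times g$ (with or without subscript) for $\langle f\pi_1,g\pi_2\rangle$, etc. Pseudo-category. A pseudo-category in $\mathbf{C}$ is a system $C=(C_0,C_1,d,c,e,m,\alpha,\lambda,\rho)$ where $C_0,C_1$ are objects, $d,c:C_1\to C_0$, $e:C_0\to C_1$, $m:C_1\times_{C_0}C_1\to C_1$ are morphisms, and $\alpha:m(1_{C_1}\times_{C_0}m)\to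 m(m\times_{C_0}1_{C_1})$, $\lambda:m\langle ec,1_{C_1}\rangle\to 1_{C_1}$, $\rho:m\langle 1_{C_1},ed\rangle\to 1_{C_1}$ are invertible 2-cells, such that - $de=1_{C_0}=ce$; $dm=d\pi_2$, $cm=c\pi_1$; - $d\circ\lambda=1_d=d\circ\rho$, $c\circ\lambda=1_c=c\circ\rho$; $d\circ\alpha=1_{d\pi_3}$, $c\circ\alpha=1_{c\pi_1}$; $\lambda\circ e=\rho\circ e$; - (pentagon) $(\alpha\circ(m\times 1\times 1))\cdot(\alpha\circ(1\times 1\times m))=(m\circ(\alpha\times 1))\cdot(\alpha\circ(1\times m\times 1))\cdot(m\circ(1\times\alpha))$; - (triangle) $(m\circ(\rho\times 1))\cdot(\alpha\circ(1\times\langle ec,1\rangle))=m\circ(1\times\lambda)$. The structure of $C'$ (resp. $C''$) is denoted by the same letters with primes (resp. double primes). Pseudo-functor. A pseudo-functor $F:C\to C'$ is a system $F=(F_0,F_1,\mu,\varepsilon)$ with morphisms $F_0:C_0\to C_0'$, $F_1:C_1\to C_1'$ and invertible 2-cells $\mu:F_1m\to m'(F_1\times_{F_0}F_1)$, $\varepsilon:F_1e\to e'F_0$ such that - $d'F_1=F_0d$, $c'F_1=F_0c$; $d'\circ\mu=1_{F_0d\pi_2}$, $c'\circ\mu=1_{F_0c\pi_1}$; $d'\circ\varepsilon=1_{F_0}=c'\circ\varepsilon$; - $(\alpha'\circ(F_1\times F_1\times F_1))\cdot(m'\circ(1_{F_1}\times\mu))\cdot(\mu\circ(1\times m))=(m'\circ(\mu\times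 1_{F_1}))\cdot(\mu\circ(m\times 1))\cdot(F_1\circ\alpha)$; - $F_1\circ\rho=(\rho'\circ F_1)\cdot(m'\langle 1_{F_1},\varepsilon\circ d\rangle)\cdot(\mu\circ\langle 1,ed\rangle)$; - $F_1\circ\lambda=(\lambda'\circ F_1)\cdot(m'\langle\varepsilon\circ c,1_{F_1}\rangle)\cdot(\mu\circ\langle ec,1\rangle)$. *)

(* Defs.v *)
From mathcomp Require Import ssreflect ssrfun.

Set Implicit Arguments.
Unset Strict Implicit.
Unset Printing Implicit Defensive.

(* Strict 2-categories. The 2-cells between A and B form a single type with
   source and target 1-cells, so that equations between 2-cells whose boundaries
   are only provably equal are plain equalities; vertical composition takes a
   proof that its arguments are composable. *)
Record twocat := TwoCat {
  ob :> Type;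
  hom : ob -> ob -> Type;
  cell : ob -> ob -> Type;
  id1 : forall A, hom A A;
  comp : forall A B X, hom B X -> hom A B -> hom A X;
  src : forall A B, cell A B -> hom A B;
  tgt : forall A B, cell A B -> hom A B;
  id2 : forall A B, hom A B -> cell A B;
  vcomp : forall A B (b a : cell A B), src b = tgt a -> cell A B;
  hcomp : forall A B X, cell B X -> cell A B -> cell A X;

  comp1A : forall A B X Y (h : hom X Y) (g : hom B X) (f : hom A B),
    comp h (comp g f) = comp (comp h g) f;
  comp1l : forall A B (f : hom A B), comp (id1 B) f = f;
  comp1r : forall A B (f : hom A B), comp f (id1 A) = f;

  src_id2 : forall A B (f : hom A B), src (id2 f) = f;
  tgt_id2 : forall A B (f : hom A B), tgt (id2 f) = f;
  src_vcomp : forall A B (b a : cell A B) (h : src b = tgt a),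
    src (vcomp h) = src a;
  tgt_vcomp : forall A B (b a : cell A B) (h : src b = tgt a),
    tgt (vcomp h) = tgt b;
  vcompA : forall A B (x y z : cell A B)
      (xy : src x = tgt y) (yz : src y = tgt z)
      (x_yz : src x = tgt (vcomp yz)) (xy_z : src (vcomp xy) = tgt z),
    vcomp x_yz = vcomp xy_z;
  vcomp1l : forall A B (a : cell A B) (h : src (id2 (tgt a)) = tgt a),
    vcomp h = a;
  vcomp1r : forall A B (a : cell A B) (h : src a = tgt (id2 (src a))),
    vcomp h = a;

  src_hcomp : forall A B X (b : cell B X) (a : cell A B),
    src (hcomp b a) = comp (src b) (src a);
  tgt_hcomp : forall A B X (b : cell B X) (a : cell A B),
    tgt (hcomp b a) = comp (tgt b) (tgt a);
  hcomp_id2 : forall A B X (g : hom B X) (f : hom A B),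
    hcomp (id2 g) (id2 f) = id2 (comp g f);
  interchange : forall A B X (b' b : cell B X) (a' a : cell A B)
      (hb : src b' = tgt b) (ha : src a' = tgt a)
      (hba : src (hcomp b' a') = tgt (hcomp b a)),
    hcomp (vcomp hb) (vcomp ha) = vcomp hba;

  hcompA : forall A B X Y (z : cell X Y) (b : cell B X) (a : cell A B),
    hcomp z (hcomp b a) = hcomp (hcomp z b) a;
  hcomp1l : forall A B (a : cell A B), hcomp (id2 (id1 B)) a = a;
  hcomp1r : forall A B (a : cell A B), hcomp a (id2 (id1 A)) = a
}.

Arguments hom {t}.
Arguments cell {t}.
Arguments id1 {t}.
Arguments comp {t A B X}.
Arguments src {t A B}.
Arguments tgt {t A B}.
Arguments id2 {t A B}.
Arguments vcomp {t A B} b a _.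
Arguments hcomp {t A B X}.

Declare Scope twocat_scope.
Delimit Scope twocat_scope with TC.
Local Open Scope twocat_scope.

Notation "g ∘ f" := (comp g f) (at level 40, left associativity)
  : twocat_scope.
Notation "g ◁ a" := (hcomp (id2 g) a) (at level 40, left associativity)
  : twocat_scope.
Notation "a ▷ f" := (hcomp a (id2 f)) (at level 40, left associativity)
  : twocat_scope.
Notation "b ⋅[ h ] a" := (vcomp b a h)
  (at level 50, left associativity, format "b  ⋅[ h ]  a") : twocat_scope.

Definition invertible (K : twocat) (A B : K) (a : cell A B) : Prop :=
  exists (b : cell A B) (ba : src b = tgt a) (ab : src a = tgt b),
    b ⋅[ba] a = id2 (src a) /\ a ⋅[ab] b = id2 (tgt a).

Record inv_cell (K : twocat) (A B : K) (a : cell A B) (f g : hom A B) : Prop :=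
  InvCell {
    inv_cell_src : src a = f;
    inv_cell_tgt : tgt a = g;
    inv_cell_inv : invertible a
  }.

Record pullback (K : twocat) (A B X : K) (f : hom A X) (g : hom B X) :=
  Pullback {
    pb_ob :> K;
    p1 : hom pb_ob A;
    p2 : hom pb_ob B;
    pb_sq : f ∘ p1 = g ∘ p2;

    pair : forall (Z : K) (u : hom Z A) (v : hom Z B),
      f ∘ u = g ∘ v -> hom Z pb_ob;
    p1_pair : forall (Z : K) (u : hom Z A) (v : hom Z B) (h : f ∘ u = g ∘ v),
      p1 ∘ pair h = u;
    p2_pair : forall (Z : K) (u : hom Z A) (v : hom Z B) (h : f ∘ u = g ∘ v),
      p2 ∘ pair h = v;
    pb_ext : forall (Z : K) (w w' : hom Z pb_ob),
      p1 ∘ w = p1 ∘ w' -> p2 ∘ w = p2 ∘ w' -> w = w';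

    cpair : forall (Z : K) (a : cell Z A) (b : cell Z B),
      f ◁ a = g ◁ b -> cell Z pb_ob;
    p1_cpair : forall (Z : K) (a : cell Z A) (b : cell Z B)
      (h : f ◁ a = g ◁ b), p1 ◁ cpair h = a;
    p2_cpair : forall (Z : K) (a : cell Z A) (b : cell Z B)
      (h : f ◁ a = g ◁ b), p2 ◁ cpair h = b;
    pb_cext : forall (Z : K) (x x' : cell Z pb_ob),
      p1 ◁ x = p1 ◁ x' -> p2 ◁ x = p2 ◁ x' -> x = x'
  }.

Arguments p1 {K A B X f g}.
Arguments p2 {K A B X f g}.
Arguments pair {K A B X f g} _ {Z} u v _.
Arguments cpair {K A B X f g} _ {Z} a b _.

Section PullbackFacts.
Context (K : twocat) (A B X : K) (f : hom A X) (g : hom B X).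
Context (P : pullback f g).

Lemma p1_pair_comp (Z W : K) (u : hom Z A) (v : hom Z B) h (w : hom W Z) :
  p1 P ∘ (pair P u v h ∘ w) = u ∘ w.
Proof. by rewrite comp1A p1_pair. Qed.

Lemma p2_pair_comp (Z W : K) (u : hom Z A) (v : hom Z B) h (w : hom W Z) :
  p2 P ∘ (pair P u v h ∘ w) = v ∘ w.
Proof. by rewrite comp1A p2_pair. Qed.

Lemma p1_src_cpair (Z : K) (a : cell Z A) (b : cell Z B) h :
  p1 P ∘ src (cpair P a b h) = src a.
Proof. by rewrite -{2}(p1_cpair P h) src_hcomp src_id2. Qed.

Lemma p2_src_cpair (Z : K) (a : cell Z A) (b : cell Z B) h :
  p2 P ∘ src (cpair P a b h) = src b.
Proof. by rewrite -{2}(p2_cpair P h) src_hcomp src_id2. Qed.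

Lemma p1_tgt_cpair (Z : K) (a : cell Z A) (b : cell Z B) h :
  p1 P ∘ tgt (cpair P a b h) = tgt a.
Proof. by rewrite -{2}(p1_cpair P h) tgt_hcomp tgt_id2. Qed.

Lemma p2_tgt_cpair (Z : K) (a : cell Z A) (b : cell Z B) h :
  p2 P ∘ tgt (cpair P a b h) = tgt b.
Proof. by rewrite -{2}(p2_cpair P h) tgt_hcomp tgt_id2. Qed.

End PullbackFacts.

Section WhiskerFacts.
Context (K : twocat).

Lemma src_whl (A B X : K) (g : hom B X) (a : cell A B) :
  src (g ◁ a) = g ∘ src a.
Proof. by rewrite src_hcomp src_id2. Qed.

Lemma tgt_whl (A B X : K) (g : hom B X) (a : cell A B) :
  tgt (g ◁ a) = g ∘ tgt a.
Proof. by rewrite tgt_hcomp tgt_id2. Qed.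

Lemma src_whr (A B X : K) (a : cell B X) (f : hom A B) :
  src (a ▷ f) = src a ∘ f.
Proof. by rewrite src_hcomp src_id2. Qed.

Lemma tgt_whr (A B X : K) (a : cell B X) (f : hom A B) :
  tgt (a ▷ f) = tgt a ∘ f.
Proof. by rewrite tgt_hcomp tgt_id2. Qed.

Lemma whl_comp (A B X Y : K) (h : hom X Y) (g : hom B X) (a : cell A B) :
  h ◁ (g ◁ a) = (h ∘ g) ◁ a.
Proof. by rewrite hcompA hcomp_id2. Qed.

Lemma whlr (A B X Y : K) (h : hom X Y) (a : cell B X) (f : hom A B) :
  h ◁ (a ▷ f) = (h ◁ a) ▷ f.
Proof. by rewrite hcompA. Qed.

End WhiskerFacts.

(* The triple and quadruple pullbacks are taken in the iterated form
   C1 ×_C0 (C1 ×_C0 C1) and C1 ×_C0 (C1 ×_C0 C1 ×_C0 C1). *)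
Record pc_frame (K : twocat) := PcFrame {
  pc0 : K;
  pc1 : K;
  dd : hom pc1 pc0;
  cc : hom pc1 pc0;
  ee : hom pc0 pc1;
  pb2 : pullback dd cc;
  pb3 : pullback dd (cc ∘ p1 pb2);
  pb4 : pullback dd (cc ∘ p1 pb3);
  mm : hom pb2 pc1;
  de : dd ∘ ee = id1 pc0;
  ce : cc ∘ ee = id1 pc0;
  dm : dd ∘ mm = dd ∘ p2 pb2;
  cm : cc ∘ mm = cc ∘ p1 pb2
}.

Arguments pc0 {K}.
Arguments pc1 {K}.
Arguments dd {K}.
Arguments cc {K}.
Arguments ee {K}.
Arguments pb2 {K}.
Arguments pb3 {K}.
Arguments pb4 {K}.
Arguments mm {K}.
Arguments de {K}.
Arguments ce {K}.
Arguments dm {K}.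
Arguments cm {K}.

Section Frame.
Context (K : twocat) (C : pc_frame K).
Local Notation d := (dd C).
Local Notation c := (cc C).
Local Notation e := (ee C).
Local Notation m := (mm C).

(* [piN i] is the i-th projection out of the N-fold pullback, and [tailN] the
   projection onto the last N - 1 components. *)
Definition pi21 : hom (pb2 C) (pc1 C) := p1 (pb2 C).
Definition pi22 : hom (pb2 C) (pc1 C) := p2 (pb2 C).
Definition tail3 : hom (pb3 C) (pb2 C) := p2 (pb3 C).
Definition pi31 : hom (pb3 C) (pc1 C) := p1 (pb3 C).
Definition pi32 : hom (pb3 C) (pc1 C) := pi21 ∘ tail3.
Definition pi33 : hom (pb3 C) (pc1 C) := pi22 ∘ tail3.
Definition tail4 : hom (pb4 C) (pb3 C) := p2 (pb4 C).
Definition pi41 : hom (pb4 C) (pc1 C) := p1 (pb4 C).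
Definition pi42 : hom (pb4 C) (pc1 C) := pi31 ∘ tail4.
Definition pi43 : hom (pb4 C) (pc1 C) := pi32 ∘ tail4.
Definition pi44 : hom (pb4 C) (pc1 C) := pi33 ∘ tail4.

Definition tup2 (Z : K) (f g : hom Z (pc1 C)) (h : d ∘ f = c ∘ g) :
  hom Z (pb2 C) := pair (pb2 C) f g h.

Lemma tup3_compat (Z : K) (f g k : hom Z (pc1 C))
  (h1 : d ∘ f = c ∘ g) (h2 : d ∘ g = c ∘ k) :
  d ∘ f = (c ∘ p1 (pb2 C)) ∘ tup2 h2.
Proof. by rewrite -comp1A p1_pair. Qed.

Definition tup3 (Z : K) (f g k : hom Z (pc1 C))
  (h1 : d ∘ f = c ∘ g) (h2 : d ∘ g = c ∘ k) : hom Z (pb3 C) :=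
  pair (pb3 C) f (tup2 h2) (tup3_compat h1 h2).

Lemma sq2 : d ∘ pi21 = c ∘ pi22.
Proof. exact: pb_sq. Qed.

Lemma sq3_12 : d ∘ pi31 = c ∘ pi32.
Proof. by rewrite /pi31 pb_sq -comp1A. Qed.

Lemma sq3_23 : d ∘ pi32 = c ∘ pi33.
Proof. by rewrite (comp1A d) sq2 -(comp1A c). Qed.

Lemma sq4_12 : d ∘ pi41 = c ∘ pi42.
Proof. by rewrite /pi41 pb_sq -comp1A. Qed.

Lemma sq4_23 : d ∘ pi42 = c ∘ pi43.
Proof. by rewrite (comp1A d) sq3_12 -(comp1A c). Qed.

Lemma sq4_34 : d ∘ pi43 = c ∘ pi44.
Proof. by rewrite (comp1A d) sq3_23 -(comp1A c). Qed.

Lemma ec_1_compat : d ∘ (e ∘ c) = c ∘ id1 (pc1 C).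
Proof. by rewrite comp1A de comp1l comp1r. Qed.

Definition ec_1 : hom (pc1 C) (pb2 C) := tup2 ec_1_compat.

Lemma one_ed_compat : d ∘ id1 (pc1 C) = c ∘ (e ∘ d).
Proof. by rewrite comp1A ce comp1l comp1r. Qed.

Definition one_ed : hom (pc1 C) (pb2 C) := tup2 one_ed_compat.

Lemma oneXm_compat : d ∘ pi31 = c ∘ (m ∘ tail3).
Proof. by rewrite comp1A cm /pi31 pb_sq. Qed.

Definition oneXm : hom (pb3 C) (pb2 C) := tup2 oneXm_compat.

Lemma mXone_compat : d ∘ (m ∘ tup2 sq3_12) = c ∘ pi33.
Proof. by rewrite comp1A dm -comp1A p2_pair sq3_23. Qed.

Definition mXone : hom (pb3 C) (pb2 C) := tup2 mXone_compat.

Lemma oneXoneXm_compat : d ∘ pi41 = (c ∘ p1 (pb2 C)) ∘ (oneXm ∘ tail4).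
Proof. by rewrite -comp1A p1_pair_comp /pi41 pb_sq comp1A. Qed.

Definition oneXoneXm : hom (pb4 C) (pb3 C) :=
  pair (pb3 C) pi41 (oneXm ∘ tail4) oneXoneXm_compat.

Lemma oneXmXone_compat : d ∘ pi41 = (c ∘ p1 (pb2 C)) ∘ (mXone ∘ tail4).
Proof.
by rewrite -comp1A p1_pair_comp !comp1A cm -(comp1A c) p1_pair sq4_12 /pi42 comp1A.
Qed.

Definition oneXmXone : hom (pb4 C) (pb3 C) :=
  pair (pb3 C) pi41 (mXone ∘ tail4) oneXmXone_compat.

Lemma mXoneXone_compat :
  d ∘ (m ∘ tup2 sq4_12) = (c ∘ p1 (pb2 C)) ∘ (tail3 ∘ tail4).
Proof.
by rewrite comp1A dm -comp1A p2_pair sq4_23 /pi43 /pi32 -!comp1A.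
Qed.

Definition mXoneXone : hom (pb4 C) (pb3 C) :=
  pair (pb3 C) (m ∘ tup2 sq4_12) (tail3 ∘ tail4) mXoneXone_compat.

Lemma oneXec_1_compat : d ∘ pi21 = (c ∘ p1 (pb2 C)) ∘ (ec_1 ∘ pi22).
Proof.
by rewrite -comp1A p1_pair_comp !comp1A ce comp1l sq2.
Qed.

(* 1 × ⟨ec, 1⟩ *)
Definition oneXec_1 : hom (pb2 C) (pb3 C) :=
  pair (pb3 C) pi21 (ec_1 ∘ pi22) oneXec_1_compat.

Definition ctup2 (Z : K) (a b : cell Z (pc1 C)) (h : d ◁ a = c ◁ b) :
  cell Z (pb2 C) := cpair (pb2 C) a b h.

End Frame.

Arguments ec_1 {K}.
Arguments one_ed {K}.
Arguments oneXm {K}.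
Arguments mXone {K}.
Arguments oneXoneXm {K}.
Arguments oneXmXone {K}.
Arguments mXoneXone {K}.
Arguments oneXec_1 {K}.

Lemma comp_whr (K : twocat) (A B X : K) (g : hom B X) (f : hom A B) (k : hom A X) :
  g ∘ f = k -> forall (Z : K) (w : hom Z A), g ∘ (f ∘ w) = k ∘ w.
Proof. by move=> <- Z w; rewrite comp1A. Qed.

(* [pb_solve] proves equations between 1-cells built from tuples: it abstracts
   the tuples, keeping the equations for their components, and compares
   components. *)
Ltac pb_unfold :=
  unfold oneXoneXm, oneXmXone, mXoneXone, oneXec_1, oneXm, mXone, ec_1,
    one_ed, tup3, tup2, pi44, pi43, pi42, pi41, pi33, pi32, pi31, pi22, pi21,
    tail4, tail3.

Ltac pb_abstract :=
  repeat match goal with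
  | |- context [@pair ?K ?A ?B ?X ?f ?g ?P ?Z ?u ?v ?h] =>
      move: (@p1_pair K A B X f g P Z u v h) (@p2_pair K A B X f g P Z u v h);
      generalize (@pair K A B X f g P Z u v h); pb_unfold
  end;
  intros.

Ltac pb_rewrite :=
  repeat first
    [ progress rewrite -?comp1A ?comp1l ?comp1r
    | match goal with
      | H : _ ∘ ?t = _ |- context [_ ∘ ?t] => rewrite !H
      | H : _ ∘ ?t = _ |- context [_ ∘ (?t ∘ _)] => rewrite !(comp_whr H)
      end ].

Ltac pb_compare :=
  pb_rewrite; first [ reflexivity | exact: pb_sq
    | apply: pb_ext; pb_compare
    | match goal with
      | |- mm _ ∘ _ = mm _ ∘ _ => congr (_ ∘ _); pb_compare
      | |- ee _ ∘ _ = ee _ ∘ _ => congr (_ ∘ _); pb_compare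
      end ].

Ltac pb_solve := pb_unfold; pb_abstract; pb_compare.

Record pc_cells (K : twocat) := PcCells {
  pc_frame_of :> pc_frame K;
  alpha : cell (pb3 pc_frame_of) (pc1 pc_frame_of);
  lambda : cell (pc1 pc_frame_of) (pc1 pc_frame_of);
  rho : cell (pc1 pc_frame_of) (pc1 pc_frame_of);
  alphaP : inv_cell alpha (mm pc_frame_of ∘ oneXm pc_frame_of)
                          (mm pc_frame_of ∘ mXone pc_frame_of);
  lambdaP : inv_cell lambda (mm pc_frame_of ∘ ec_1 pc_frame_of) (id1 _);
  rhoP : inv_cell rho (mm pc_frame_of ∘ one_ed pc_frame_of) (id1 _);
  d_lambda : dd pc_frame_of ◁ lambda = id2 (dd pc_frame_of);
  d_rho : dd pc_frame_of ◁ rho = id2 (dd pc_frame_of);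
  c_lambda : cc pc_frame_of ◁ lambda = id2 (cc pc_frame_of);
  c_rho : cc pc_frame_of ◁ rho = id2 (cc pc_frame_of);
  d_alpha : dd pc_frame_of ◁ alpha = id2 (dd pc_frame_of ∘ pi33 pc_frame_of);
  c_alpha : cc pc_frame_of ◁ alpha = id2 (cc pc_frame_of ∘ pi31 pc_frame_of);
  lambda_rho_e : lambda ▷ ee pc_frame_of = rho ▷ ee pc_frame_of
}.

Arguments alpha {K}.
Arguments lambda {K}.
Arguments rho {K}.

Section Cells.
Context (K : twocat) (C : pc_cells K).
Local Notation d := (dd C).
Local Notation c := (cc C).
Local Notation e := (ee C).
Local Notation m := (mm C).

Lemma alphaXone_compat :
  d ◁ (alpha C ▷ tup3 (sq4_12 C) (sq4_23 C)) = c ◁ id2 (pi44 C).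
Proof.
rewrite whlr d_alpha !hcomp_id2 -sq4_34; congr id2.
by rewrite -comp1A /pi33 -comp1A p2_pair p2_pair.
Qed.

Definition alphaXone : cell (pb4 C) (pb2 C) := ctup2 alphaXone_compat.

Lemma oneXalpha_compat : d ◁ id2 (pi41 C) = c ◁ (alpha C ▷ tail4 C).
Proof. by rewrite whlr c_alpha !hcomp_id2 -comp1A sq4_12. Qed.

Definition oneXalpha : cell (pb4 C) (pb2 C) := ctup2 oneXalpha_compat.

Lemma rhoXone_compat : d ◁ (rho C ▷ pi21 C) = c ◁ id2 (pi22 C).
Proof. by rewrite whlr d_rho !hcomp_id2 sq2. Qed.

Definition rhoXone : cell (pb2 C) (pb2 C) := ctup2 rhoXone_compat.

Lemma oneXlambda_compat : d ◁ id2 (pi21 C) = c ◁ (lambda C ▷ pi22 C).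
Proof. by rewrite whlr c_lambda !hcomp_id2 sq2. Qed.

Definition oneXlambda : cell (pb2 C) (pb2 C) := ctup2 oneXlambda_compat.

Lemma pentagon_lhs_compat :
  src (alpha C ▷ mXoneXone C) = tgt (alpha C ▷ oneXoneXm C).
Proof.
rewrite src_whr tgt_whr (inv_cell_src (alphaP C)) (inv_cell_tgt (alphaP C)).
by pb_solve.
Qed.

Lemma pentagon_rhs_compat1 :
  src (m ◁ alphaXone) = tgt (alpha C ▷ oneXmXone C).
Proof.
rewrite src_whl tgt_whr (inv_cell_tgt (alphaP C)) -comp1A; congr (_ ∘ _).
apply: pb_ext.
- by rewrite p1_src_cpair src_whr (inv_cell_src (alphaP C)); pb_solve.
- by rewrite p2_src_cpair src_id2; pb_solve.
Qed.

Lemma pentagon_rhs_compat2 :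
  src (m ◁ alphaXone ⋅[pentagon_rhs_compat1] (alpha C ▷ oneXmXone C))
  = tgt (m ◁ oneXalpha).
Proof.
rewrite src_vcomp src_whr tgt_whl (inv_cell_src (alphaP C)) -comp1A; congr (_ ∘ _).
apply: pb_ext.
- by rewrite p1_tgt_cpair tgt_id2; pb_solve.
- by rewrite p2_tgt_cpair tgt_whr (inv_cell_tgt (alphaP C)); pb_solve.
Qed.

Lemma triangle_compat : src (m ◁ rhoXone) = tgt (alpha C ▷ oneXec_1 C).
Proof.
rewrite src_whl tgt_whr (inv_cell_tgt (alphaP C)) -comp1A; congr (_ ∘ _).
apply: pb_ext.
- by rewrite p1_src_cpair src_whr (inv_cell_src (rhoP C)); pb_solve.
- by rewrite p2_src_cpair src_id2; pb_solve.
Qed.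

End Cells.

Arguments alphaXone {K}.
Arguments oneXalpha {K}.
Arguments rhoXone {K}.
Arguments oneXlambda {K}.

Record pseudocat (K : twocat) := PseudoCat {
  pc_cells_of :> pc_cells K;
  pentagon :
    (alpha pc_cells_of ▷ mXoneXone pc_cells_of)
      ⋅[pentagon_lhs_compat pc_cells_of]
    (alpha pc_cells_of ▷ oneXoneXm pc_cells_of)
    = (mm pc_cells_of ◁ alphaXone pc_cells_of)
        ⋅[pentagon_rhs_compat1 pc_cells_of]
      (alpha pc_cells_of ▷ oneXmXone pc_cells_of)
        ⋅[pentagon_rhs_compat2 pc_cells_of]
      (mm pc_cells_of ◁ oneXalpha pc_cells_of);
  triangle :
    (mm pc_cells_of ◁ rhoXone pc_cells_of)
      ⋅[triangle_compat pc_cells_of]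
    (alpha pc_cells_of ▷ oneXec_1 pc_cells_of)
    = mm pc_cells_of ◁ oneXlambda pc_cells_of
}.

Record pf_data (K : twocat) (C C' : pc_frame K) := PfData {
  pf0 : hom (pc0 C) (pc0 C');
  pf1 : hom (pc1 C) (pc1 C');
  mu : cell (pb2 C) (pc1 C');
  eps : cell (pc0 C) (pc1 C')
}.

Section FrameMaps.
Context (K : twocat) (C C' : pc_frame K) (F : pf_data C C').
Context (dF : dd C' ∘ pf1 F = pf0 F ∘ dd C).
Context (cF : cc C' ∘ pf1 F = pf0 F ∘ cc C).

Lemma map_compat (Z : K) (f g : hom Z (pc1 C)) (h : dd C ∘ f = cc C ∘ g) :
  dd C' ∘ (pf1 F ∘ f) = cc C' ∘ (pf1 F ∘ g).
Proof. by rewrite !comp1A dF cF -!comp1A h. Qed.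

(* F1 ×_F0 F1 and F1 ×_F0 F1 ×_F0 F1 *)
Definition map2 : hom (pb2 C) (pb2 C') := tup2 (map_compat (sq2 C)).

Definition map3 : hom (pb3 C) (pb3 C') :=
  tup3 (map_compat (sq3_12 C)) (map_compat (sq3_23 C)).

End FrameMaps.

Record pf_bounds (K : twocat) (C C' : pc_frame K) (F : pf_data C C') : Prop :=
  PfBounds {
    d_pf1 : dd C' ∘ pf1 F = pf0 F ∘ dd C;
    c_pf1 : cc C' ∘ pf1 F = pf0 F ∘ cc C;
    muP : inv_cell (mu F) (pf1 F ∘ mm C) (mm C' ∘ map2 d_pf1 c_pf1);
    epsP : inv_cell (eps F) (pf1 F ∘ ee C) (ee C' ∘ pf0 F);
    d_mu : dd C' ◁ mu F = id2 (pf0 F ∘ dd C ∘ pi22 C);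
    c_mu : cc C' ◁ mu F = id2 (pf0 F ∘ cc C ∘ pi21 C);
    d_eps : dd C' ◁ eps F = id2 (pf0 F);
    c_eps : cc C' ◁ eps F = id2 (pf0 F)
  }.

Section Coherence.
Context (K : twocat) (C C' : pc_cells K) (F : pf_data C C').
Context (HF : pf_bounds F).
Local Notation d := (dd C).
Local Notation c := (cc C).
Local Notation e := (ee C).
Local Notation m := (mm C).
Local Notation d' := (dd C').
Local Notation c' := (cc C').
Local Notation e' := (ee C').
Local Notation m' := (mm C').
Local Notation F0 := (pf0 F).
Local Notation F1 := (pf1 F).

Definition pf2 : hom (pb2 C) (pb2 C') := map2 (d_pf1 HF) (c_pf1 HF).
Definition pf3 : hom (pb3 C) (pb3 C') := map3 (d_pf1 HF) (c_pf1 HF).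

Lemma src_mu : src (mu F) = F1 ∘ m.
Proof. exact: inv_cell_src (muP HF). Qed.

Lemma tgt_mu : tgt (mu F) = m' ∘ pf2.
Proof. exact: inv_cell_tgt (muP HF). Qed.

Lemma src_eps : src (eps F) = F1 ∘ e.
Proof. exact: inv_cell_src (epsP HF). Qed.

Lemma tgt_eps : tgt (eps F) = e' ∘ F0.
Proof. exact: inv_cell_tgt (epsP HF). Qed.

Lemma oneXmu_compat : d' ◁ id2 (F1 ∘ pi31 C) = c' ◁ (mu F ▷ tail3 C).
Proof.
rewrite whlr (c_mu HF) !hcomp_id2; congr id2.
by rewrite comp1A (d_pf1 HF) -!comp1A sq3_12.
Qed.

Definition oneXmu : cell (pb3 C) (pb2 C') := ctup2 oneXmu_compat.

Lemma muXone_compat :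
  d' ◁ (mu F ▷ tup2 (sq3_12 C)) = c' ◁ id2 (F1 ∘ pi33 C).
Proof.
rewrite whlr (d_mu HF) !hcomp_id2; congr id2.
by rewrite comp1A (c_pf1 HF) -!comp1A p2_pair sq3_23.
Qed.

Definition muXone : cell (pb3 C) (pb2 C') := ctup2 muXone_compat.

Lemma one_epsd_compat : d' ◁ id2 F1 = c' ◁ (eps F ▷ d).
Proof. by rewrite whlr (c_eps HF) !hcomp_id2 (d_pf1 HF). Qed.

Definition one_epsd : cell (pc1 C) (pb2 C') := ctup2 one_epsd_compat.

Lemma epsc_one_compat : d' ◁ (eps F ▷ c) = c' ◁ id2 F1.
Proof. by rewrite whlr (d_eps HF) !hcomp_id2 (c_pf1 HF). Qed.

Definition epsc_one : cell (pc1 C) (pb2 C') := ctup2 epsc_one_compat.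

Lemma pf_assoc_lhs_compat1 : src (alpha C' ▷ pf3) = tgt (m' ◁ oneXmu).
Proof.
rewrite src_whr tgt_whl (inv_cell_src (alphaP C')) -comp1A; congr (_ ∘ _).
rewrite /pf2 /pf3 /map2 /map3; apply: pb_ext.
- by rewrite p1_tgt_cpair tgt_id2; pb_solve.
- by rewrite p2_tgt_cpair tgt_whr tgt_mu /pf2 /map2; pb_solve.
Qed.

Lemma pf_assoc_lhs_compat2 :
  src ((alpha C' ▷ pf3) ⋅[pf_assoc_lhs_compat1] (m' ◁ oneXmu))
  = tgt (mu F ▷ oneXm C).
Proof.
rewrite src_vcomp src_whl tgt_whr tgt_mu -comp1A; congr (_ ∘ _).
rewrite /pf2 /pf3 /map2 /map3; apply: pb_ext.
- by rewrite p1_src_cpair src_id2; pb_solve.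
- by rewrite p2_src_cpair src_whr src_mu; pb_solve.
Qed.

Lemma pf_assoc_rhs_compat1 : src (m' ◁ muXone) = tgt (mu F ▷ mXone C).
Proof.
rewrite src_whl tgt_whr tgt_mu -comp1A; congr (_ ∘ _).
rewrite /pf2 /pf3 /map2 /map3; apply: pb_ext.
- by rewrite p1_src_cpair src_whr src_mu; pb_solve.
- by rewrite p2_src_cpair src_id2; pb_solve.
Qed.

Lemma pf_assoc_rhs_compat2 :
  src ((m' ◁ muXone) ⋅[pf_assoc_rhs_compat1] (mu F ▷ mXone C))
  = tgt (F1 ◁ alpha C).
Proof.
by rewrite src_vcomp src_whr tgt_whl src_mu (inv_cell_tgt (alphaP C)) comp1A.
Qed.

Lemma pf_rho_compat1 : src (rho C' ▷ F1) = tgt (m' ◁ one_epsd).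
Proof.
rewrite src_whr tgt_whl (inv_cell_src (rhoP C')) -comp1A; congr (_ ∘ _).
rewrite /pf2 /pf3 /map2 /map3; apply: pb_ext.
- by rewrite p1_tgt_cpair tgt_id2; pb_solve.
- by rewrite p2_tgt_cpair tgt_whr tgt_eps -comp1A -(d_pf1 HF); pb_solve.
Qed.

Lemma pf_rho_compat2 :
  src ((rho C' ▷ F1) ⋅[pf_rho_compat1] (m' ◁ one_epsd)) = tgt (mu F ▷ one_ed C).
Proof.
rewrite src_vcomp src_whl tgt_whr tgt_mu -comp1A; congr (_ ∘ _).
rewrite /pf2 /pf3 /map2 /map3; apply: pb_ext.
- by rewrite p1_src_cpair src_id2; pb_solve.
- by rewrite p2_src_cpair src_whr src_eps; pb_solve.
Qed.

Lemma pf_lambda_compat1 : src (lambda C' ▷ F1) = tgt (m' ◁ epsc_one).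
Proof.
rewrite src_whr tgt_whl (inv_cell_src (lambdaP C')) -comp1A; congr (_ ∘ _).
rewrite /pf2 /pf3 /map2 /map3; apply: pb_ext.
- by rewrite p1_tgt_cpair tgt_whr tgt_eps -comp1A -(c_pf1 HF); pb_solve.
- by rewrite p2_tgt_cpair tgt_id2; pb_solve.
Qed.

Lemma pf_lambda_compat2 :
  src ((lambda C' ▷ F1) ⋅[pf_lambda_compat1] (m' ◁ epsc_one))
  = tgt (mu F ▷ ec_1 C).
Proof.
rewrite src_vcomp src_whl tgt_whr tgt_mu -comp1A; congr (_ ∘ _).
rewrite /pf2 /pf3 /map2 /map3; apply: pb_ext.
- by rewrite p1_src_cpair src_whr src_eps; pb_solve.
- by rewrite p2_src_cpair src_id2; pb_solve.
Qed.

Record pf_coherence : Prop := PfCoherence {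
  pf_assoc :
    (alpha C' ▷ pf3) ⋅[pf_assoc_lhs_compat1] (m' ◁ oneXmu)
      ⋅[pf_assoc_lhs_compat2] (mu F ▷ oneXm C)
    = (m' ◁ muXone) ⋅[pf_assoc_rhs_compat1] (mu F ▷ mXone C)
        ⋅[pf_assoc_rhs_compat2] (F1 ◁ alpha C);
  pf_rho :
    F1 ◁ rho C
    = (rho C' ▷ F1) ⋅[pf_rho_compat1] (m' ◁ one_epsd)
        ⋅[pf_rho_compat2] (mu F ▷ one_ed C);
  pf_lambda :
    F1 ◁ lambda C
    = (lambda C' ▷ F1) ⋅[pf_lambda_compat1] (m' ◁ epsc_one)
        ⋅[pf_lambda_compat2] (mu F ▷ ec_1 C)
}.

End Coherence.

Record is_pseudofunctor (K : twocat) (C C' : pseudocat K) (F : pf_data C C') :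
  Prop := IsPseudoFunctor {
    pf_boundsP : pf_bounds F;
    pf_coherenceP : pf_coherence pf_boundsP
  }.

Record pseudofunctor (K : twocat) (C C' : pseudocat K) := PseudoFunctor {
  pf_data_of :> pf_data C C';
  pseudofunctorP : is_pseudofunctor pf_data_of
}.

Section Composition.
Context (K : twocat) (C C' C'' : pseudocat K).
Context (F : pseudofunctor C C') (G : pseudofunctor C' C'').

(* F1 ×_F0 F1 *)
Definition pf_square : hom (pb2 C) (pb2 C') :=
  pf2 (pf_boundsP (pseudofunctorP F)).

Lemma pf_comp_mu_compat : src (mu G ▷ pf_square) = tgt (pf1 G ◁ mu F).
Proof.
rewrite src_whr tgt_whl (src_mu (pf_boundsP (pseudofunctorP G))).
by rewrite (tgt_mu (pf_boundsP (pseudofunctorP F))) comp1A.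
Qed.

Lemma pf_comp_eps_compat : src (eps G ▷ pf0 F) = tgt (pf1 G ◁ eps F).
Proof.
rewrite src_whr tgt_whl (src_eps (pf_boundsP (pseudofunctorP G))).
by rewrite (tgt_eps (pf_boundsP (pseudofunctorP F))) comp1A.
Qed.

Definition pf_comp : pf_data C C'' := {|
  pf0 := pf0 G ∘ pf0 F;
  pf1 := pf1 G ∘ pf1 F;
  mu := (mu G ▷ pf_square) ⋅[pf_comp_mu_compat] (pf1 G ◁ mu F);
  eps := (eps G ▷ pf0 F) ⋅[pf_comp_eps_compat] (pf1 G ◁ eps F)
|}.

End Composition.

(* Main.v *)
From Stdlib Require Import Setoid Morphisms List.
From mathcomp Require Import ssreflect ssrfun.
Require Import Defs.

Set Implicit Arguments.
Unset Strict Implicit.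
Unset Printing Implicit Defensive.

Import ListNotations.
Local Open Scope twocat_scope.

(** The 2-cell mu^GF has two halves, G1 mu^F followed by mu^G (F1 x F1), and
    likewise for eps^GF. The boundary conditions of the composite hold half by
    half. Each coherence condition of GF is obtained by pasting the condition of
    G, whiskered on the right by F, to the condition of F, whiskered on the
    left by G1. Three facts make the two pastings meet:

    - a 2-cell into a pullback built from a component of GF, such as
      1 x mu^GF, splits vertically into the one of G whiskered by F and the one
      of F whiskered by G1 x G1 ([chain_oneXmu_comp] and its three companions),
      because 2-cells into a pullback are determined by their projections;
    - mu^GF itself splits by definition ([chain_mu_comp]);
    - the half of the first coming from F and the half of the second coming
      from G stand in the wrong order, and naturality of mu^G, that is the
      interchange law, swaps them ([chain_slide_mu]).

    For associativity, after the swap the three cells of G stand side by side,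
    so that the axiom of G applies; it brings G1 alpha' next to the cells of F,
    the axiom of F applies, and a second swap yields the other side
    ([pf_comp_assoc]). The unit conditions need one swap only.

    A vertical composite carries a proof that its factors match, which makes
    rewriting inside a long composite awkward. The computations therefore take
    place in lists of 2-cells, up to having the same vertical composites
    ([chain_eq]): replacing a factor or a block of factors is then setoid
    rewriting, and no matching proof occurs in the terms. *)

(** * Vertical composition and whiskering *)

Section Vertical.
Context (K : twocat).

(** Associativity is assumed for arbitrary matching proofs; taking the middle
    factor to be an identity turns it into independence of these proofs. *)
Lemma vcomp_irr (A B : K) (b a : cell A B) (h h' : src b = tgt a) :
  b ⋅[h] a = b ⋅[h'] a.
Proof.
have yz : src (id2 (tgt a)) = tgt a by rewrite src_id2.
have xy : src b = tgt (id2 (tgt a)) by rewrite tgt_id2.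
have xy_z : src (b ⋅[xy] id2 (tgt a)) = tgt a by rewrite src_vcomp src_id2.
move: (@vcompA K A B b (id2 (tgt a)) a xy yz); rewrite vcomp1l => assoc.
by rewrite (assoc h xy_z) (assoc h' xy_z).
Qed.

Lemma eq_vcomp (A B : K) (b b' a a' : cell A B) h h' :
  b = b' -> a = a' -> b ⋅[h] a = b' ⋅[h'] a'.
Proof. by move=> eb ea; subst; apply: vcomp_irr. Qed.

Lemma vcomp_idl (A B : K) (f : hom A B) (a : cell A B) h :
  f = tgt a -> id2 f ⋅[h] a = a.
Proof. by move=> ef; subst; apply: vcomp1l. Qed.

Lemma vcomp_id2 (A B : K) (f : hom A B) h : id2 f ⋅[h] id2 f = id2 f.
Proof. exact: vcomp_idl (esym (tgt_id2 f)). Qed.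

Lemma composable_whl (A B X : K) (g : hom B X) (b a : cell A B) :
  src b = tgt a -> src (g ◁ b) = tgt (g ◁ a).
Proof. by rewrite src_whl tgt_whl => ->. Qed.

Lemma composable_whr (A B X : K) (b a : cell B X) (f : hom A B) :
  src b = tgt a -> src (b ▷ f) = tgt (a ▷ f).
Proof. by rewrite src_whr tgt_whr => ->. Qed.

Lemma whl_vcomp (A B X : K) (g : hom B X) (b a : cell A B) h :
  g ◁ (b ⋅[h] a) = (g ◁ b) ⋅[composable_whl g h] (g ◁ a).
Proof.
have hg : src (id2 g) = tgt (id2 g) by rewrite src_id2 tgt_id2.
by rewrite -{1}(vcomp_id2 hg) (interchange hg h (composable_whl g h)).
Qed.

Lemma whr_vcomp (A B X : K) (b a : cell B X) (f : hom A B) h :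
  (b ⋅[h] a) ▷ f = (b ▷ f) ⋅[composable_whr f h] (a ▷ f).
Proof.
have hf : src (id2 f) = tgt (id2 f) by rewrite src_id2 tgt_id2.
by rewrite -{1}(vcomp_id2 hf) (interchange h hf (composable_whr f h)).
Qed.

Lemma whr_comp (A B X Y : K) (a : cell X Y) (g : hom B X) (f : hom A B) :
  a ▷ g ▷ f = a ▷ (g ∘ f).
Proof. by rewrite -hcompA hcomp_id2. Qed.

(** Both sides are the horizontal composite of [b] and [a]. *)
Lemma slide (A B X : K) (b : cell B X) (a : cell A B) h h' :
  (tgt b ◁ a) ⋅[h] (b ▷ src a) = (b ▷ tgt a) ⋅[h'] (src b ◁ a).
Proof.
have hb : src (id2 (tgt b)) = tgt b by rewrite src_id2.
have hb' : src b = tgt (id2 (src b)) by rewrite tgt_id2.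
have ha : src (id2 (tgt a)) = tgt a by rewrite src_id2.
have ha' : src a = tgt (id2 (src a)) by rewrite tgt_id2.
rewrite -(interchange hb ha') -(interchange hb' ha).
by rewrite !vcomp1l !vcomp1r.
Qed.

(** * Chains of vertically composable 2-cells *)

Section Chains.
Context (A B : K).
Implicit Types (a b r : cell A B) (s t : list (cell A B)).

(** The identity ending every chain may be any one that matches, so the empty
    chain has all identities as composites and a nonempty chain has at most
    one composite; see [pastes1]. *)
Fixpoint pastes s r : Prop :=
  match s with
  | [] => exists f, r = id2 f
  | a :: s' => exists r' (h : src a = tgt r'), pastes s' r' /\ r = a ⋅[h] r'
  end.

(** Chains that cannot be composed are all equivalent; this is what frees
    rules such as [chain_vcomp] from conditions on the rest of the chain. *)
Definition chain_eq s t := forall r, pastes s r <-> pastes t r.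

#[global] Instance chain_eq_equivalence : Equivalence chain_eq.
Proof.
split=> [s r | s t st r | s t u st tu r] //.
- by rewrite st.
- by rewrite st.
Qed.

#[global] Instance chain_eq_cons : Proper (eq ==> chain_eq ==> chain_eq) cons.
Proof.
move=> a _ <- s t st r /=.
by split=> -[r' [h [/st p ->]]]; exists r', h.
Qed.

Lemma pastes1 a r : pastes [a] r <-> r = a.
Proof.
split=> [[r' [h [[f er'] ->]]] | ->].
- subst r'; have ef : src a = f by rewrite h tgt_id2.
  by subst f; apply: vcomp1r.
- have h : src a = tgt (id2 (src a)) by rewrite tgt_id2.
  exists (id2 (src a)), h; split; first by exists (src a).
  by rewrite vcomp1r.
Qed.

Lemma chain_eq_inj a b : chain_eq [a] [b] -> a = b.
Proof. by move=> /(_ a) [+ _] => /(_ (proj2 (pastes1 a a) erefl)) /pastes1. Qed.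

(** Read from left to right, this rule erases matching proofs and
    parentheses; it contains associativity. *)
Lemma chain_vcomp b a h s : chain_eq ((b ⋅[h] a) :: s) (b :: a :: s).
Proof.
move=> r; split=> [[r' [k [p ->]]] | [q [k [[r' [l [p eq]]] ->]]]] /=.
- have l : src a = tgt r' by rewrite -k src_vcomp.
  have k' : src b = tgt (a ⋅[l] r') by rewrite tgt_vcomp.
  exists (a ⋅[l] r'), k'; split; first by exists r', l.
  by rewrite (vcompA k' k).
- subst q; have k' : src (b ⋅[h] a) = tgt r' by rewrite src_vcomp.
  by exists r', k'; split=> //; rewrite (vcompA k k').
Qed.

Lemma chain_id2 f a s : tgt a = f -> chain_eq (id2 f :: a :: s) (a :: s).
Proof.
move=> <-.
have h : src (id2 (tgt a)) = tgt a by rewrite src_id2.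
by rewrite -(chain_vcomp h) vcomp1l.
Qed.

Lemma invertible_vcomp b a h :
  invertible b -> invertible a -> invertible (b ⋅[h] a).
Proof.
move=> [b' [b'b [bb' [eb eb']]]] [a' [a'a [aa' [ea ea']]]].
have k : src a' = tgt b' by rewrite a'a -h.
exists (a' ⋅[k] b').
have k1 : src (a' ⋅[k] b') = tgt (b ⋅[h] a) by rewrite src_vcomp tgt_vcomp.
have k2 : src (b ⋅[h] a) = tgt (a' ⋅[k] b') by rewrite src_vcomp tgt_vcomp.
exists k1, k2; split; apply: chain_eq_inj; rewrite !chain_vcomp.
- rewrite -(chain_vcomp b'b) eb chain_id2 //.
  by rewrite -(chain_vcomp a'a) ea src_vcomp.
- rewrite -(chain_vcomp aa') ea' chain_id2; last by rewrite -h.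
  by rewrite -(chain_vcomp bb') eb' tgt_vcomp.
Qed.

End Chains.

Lemma chain_whl (A B X : K) (g : hom B X) (b a : cell A B) h s :
  chain_eq (g ◁ (b ⋅[h] a) :: s) (g ◁ b :: g ◁ a :: s).
Proof. by rewrite whl_vcomp chain_vcomp. Qed.

Lemma chain_whr (A B X : K) (b a : cell B X) (f : hom A B) h s :
  chain_eq ((b ⋅[h] a) ▷ f :: s) (b ▷ f :: a ▷ f :: s).
Proof. by rewrite whr_vcomp chain_vcomp. Qed.

Lemma chain_eq_whl3 (A B X : K) (g : hom B X) (x y z x' y' z' : cell A B)
    xy xyz xy' xyz' :
  x ⋅[xy] y ⋅[xyz] z = x' ⋅[xy'] y' ⋅[xyz'] z' ->
  forall s, chain_eq (g ◁ x :: g ◁ y :: g ◁ z :: s)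
                     (g ◁ x' :: g ◁ y' :: g ◁ z' :: s).
Proof.
by move=> e s; rewrite -(chain_whl _ xy) -(chain_whl _ xyz) e !chain_whl.
Qed.

Lemma chain_eq_whr3 (A B X : K) (f : hom A B) (x y z x' y' z' : cell B X)
    xy xyz xy' xyz' :
  x ⋅[xy] y ⋅[xyz] z = x' ⋅[xy'] y' ⋅[xyz'] z' ->
  forall s, chain_eq (x ▷ f :: y ▷ f :: z ▷ f :: s)
                     (x' ▷ f :: y' ▷ f :: z' ▷ f :: s).
Proof.
by move=> e s; rewrite -(chain_whr _ xy) -(chain_whr _ xyz) e !chain_whr.
Qed.

(** [slide] with the boundaries given by equations, since those of the
    structure cells hold only up to a provable equality. *)
Lemma chain_slide (A B X : K) (b : cell B X) (a : cell A B)
    (g g' : hom B X) (f f' : hom A B) s :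
  src b = g -> tgt b = g' -> src a = f -> tgt a = f' ->
  chain_eq ((g' ◁ a) :: (b ▷ f) :: s) ((b ▷ f') :: (g ◁ a) :: s).
Proof.
move=> <- <- <- <-.
have h : src (tgt b ◁ a) = tgt (b ▷ src a) by rewrite src_whl tgt_whr.
have h' : src (b ▷ tgt a) = tgt (src b ◁ a) by rewrite src_whr tgt_whl.
by rewrite -(chain_vcomp h) (slide h h') chain_vcomp.
Qed.

Lemma invertible_whl (A B X : K) (g : hom B X) (a : cell A B) :
  invertible a -> invertible (g ◁ a).
Proof.
move=> [a' [a'a [aa' [ea ea']]]].
exists (g ◁ a'), (composable_whl g a'a), (composable_whl g aa').
by rewrite -!whl_vcomp ea ea' !hcomp_id2 src_whl tgt_whl.
Qed.

Lemma invertible_whr (A B X : K) (a : cell B X) (f : hom A B) :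
  invertible a -> invertible (a ▷ f).
Proof.
move=> [a' [a'a [aa' [ea ea']]]].
exists (a' ▷ f), (composable_whr f a'a), (composable_whr f aa').
by rewrite -!whr_vcomp ea ea' !hcomp_id2 src_whr tgt_whr.
Qed.

End Vertical.

(** * Boundaries of the cells in the coherence conditions *)

Section Boundaries.
Context (K : twocat) (C C' : pc_cells K) (F : pf_data C C').
Context (HF : pf_bounds F).

Lemma src_oneXmu : src (oneXmu HF) = pf2 HF ∘ oneXm C.
Proof.
rewrite /pf2 /map2; apply: pb_ext.
- by rewrite p1_src_cpair src_id2; pb_solve.
- by rewrite p2_src_cpair src_whr (src_mu HF); pb_solve.
Qed.

Lemma tgt_oneXmu : tgt (oneXmu HF) = oneXm C' ∘ pf3 HF.
Proof.
rewrite /pf3 /map3; apply: pb_ext.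
- by rewrite p1_tgt_cpair tgt_id2; pb_solve.
- by rewrite p2_tgt_cpair tgt_whr (tgt_mu HF) /pf2 /map2; pb_solve.
Qed.

Lemma src_muXone : src (muXone HF) = pf2 HF ∘ mXone C.
Proof.
rewrite /pf2 /map2; apply: pb_ext.
- by rewrite p1_src_cpair src_whr (src_mu HF); pb_solve.
- by rewrite p2_src_cpair src_id2; pb_solve.
Qed.

Lemma tgt_muXone : tgt (muXone HF) = mXone C' ∘ pf3 HF.
Proof.
rewrite /pf3 /map3; apply: pb_ext.
- by rewrite p1_tgt_cpair tgt_whr (tgt_mu HF) /pf2 /map2; pb_solve.
- by rewrite p2_tgt_cpair tgt_id2; pb_solve.
Qed.

Lemma src_one_epsd : src (one_epsd HF) = pf2 HF ∘ one_ed C.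
Proof.
rewrite /pf2 /map2; apply: pb_ext.
- by rewrite p1_src_cpair src_id2; pb_solve.
- by rewrite p2_src_cpair src_whr (src_eps HF); pb_solve.
Qed.

Lemma tgt_one_epsd : tgt (one_epsd HF) = one_ed C' ∘ pf1 F.
Proof.
apply: pb_ext.
- by rewrite p1_tgt_cpair tgt_id2; pb_solve.
- by rewrite p2_tgt_cpair tgt_whr (tgt_eps HF) -comp1A -(d_pf1 HF); pb_solve.
Qed.

Lemma src_epsc_one : src (epsc_one HF) = pf2 HF ∘ ec_1 C.
Proof.
rewrite /pf2 /map2; apply: pb_ext.
- by rewrite p1_src_cpair src_whr (src_eps HF); pb_solve.
- by rewrite p2_src_cpair src_id2; pb_solve.
Qed.

Lemma tgt_epsc_one : tgt (epsc_one HF) = ec_1 C' ∘ pf1 F.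
Proof.
apply: pb_ext.
- by rewrite p1_tgt_cpair tgt_whr (tgt_eps HF) -comp1A -(c_pf1 HF); pb_solve.
- by rewrite p2_tgt_cpair tgt_id2; pb_solve.
Qed.

Lemma p1_pf2 : p1 (pb2 C') ∘ pf2 HF = pf1 F ∘ pi21 C.
Proof. exact: p1_pair. Qed.

Lemma p2_pf2 : p2 (pb2 C') ∘ pf2 HF = pf1 F ∘ pi22 C.
Proof. exact: p2_pair. Qed.

Lemma p1_pf3 : p1 (pb3 C') ∘ pf3 HF = pf1 F ∘ pi31 C.
Proof. exact: p1_pair. Qed.

Lemma p2_pf3 : p2 (pb3 C') ∘ pf3 HF = pf2 HF ∘ tail3 C.
Proof. by rewrite /pf3 /map3 /pf2 /map2; pb_solve. Qed.

(** Compatibility with the projection onto the first two components, through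
    which the triple pullback enters mu x 1. *)
Lemma pf3_init :
  tup2 (sq3_12 C') ∘ pf3 HF = pf2 HF ∘ tup2 (sq3_12 C).
Proof. by rewrite /pf3 /map3 /pf2 /map2; pb_solve. Qed.

End Boundaries.

(** * The composite of two pseudo-functors *)

Section Composite.
Context (K : twocat) (C C' C'' : pseudocat K).
Context (F : pseudofunctor C C') (G : pseudofunctor C' C'').
Local Notation HF := (pf_boundsP (pseudofunctorP F)).
Local Notation HG := (pf_boundsP (pseudofunctorP G)).
Local Notation GF := (pf_comp F G).

Lemma d_pf1_comp : dd C'' ∘ pf1 GF = pf0 GF ∘ dd C.
Proof. by rewrite /= comp1A (d_pf1 HG) -!comp1A (d_pf1 HF). Qed.

Lemma c_pf1_comp : cc C'' ∘ pf1 GF = pf0 GF ∘ cc C.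
Proof. by rewrite /= comp1A (c_pf1 HG) -!comp1A (c_pf1 HF). Qed.

Lemma map2_comp dGF cGF : @map2 K C C'' GF dGF cGF = pf2 HG ∘ pf2 HF.
Proof. by rewrite /pf2 /map2 /=; pb_solve. Qed.

(** The composite 2-cells are sent to identities by d and c because each of
    their halves is; the remaining work is to recognise the same identity. *)
Lemma pf_comp_bounds : pf_bounds GF.
Proof.
apply: (@PfBounds K C C'' GF d_pf1_comp c_pf1_comp) => /=.
- split.
  + by rewrite src_vcomp src_whl (src_mu HF) comp1A.
  + by rewrite tgt_vcomp tgt_whr (tgt_mu HG) map2_comp comp1A.
  + apply: invertible_vcomp.
    * exact: invertible_whr (inv_cell_inv (muP HG)).
    * exact: invertible_whl (inv_cell_inv (muP HF)).
- split.
  + by rewrite src_vcomp src_whl (src_eps HF) comp1A.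
  + by rewrite tgt_vcomp tgt_whr (tgt_eps HG) comp1A.
  + apply: invertible_vcomp.
    * exact: invertible_whr (inv_cell_inv (epsP HG)).
    * exact: invertible_whl (inv_cell_inv (epsP HF)).
- rewrite whl_vcomp -[RHS]vcomp_id2 ?src_id2 ?tgt_id2 // => h.
  apply: eq_vcomp.
  + rewrite whlr (d_mu HG) hcomp_id2 /pf_square -!comp1A; congr (id2 (_ ∘ _)).
    by rewrite p2_pf2 comp1A (d_pf1 HF) -comp1A.
  + by rewrite whl_comp (d_pf1 HG) -whl_comp (d_mu HF) hcomp_id2 !comp1A.
- rewrite whl_vcomp -[RHS]vcomp_id2 ?src_id2 ?tgt_id2 // => h.
  apply: eq_vcomp.
  + rewrite whlr (c_mu HG) hcomp_id2 /pf_square -!comp1A; congr (id2 (_ ∘ _)).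
    by rewrite p1_pf2 comp1A (c_pf1 HF) -comp1A.
  + by rewrite whl_comp (c_pf1 HG) -whl_comp (c_mu HF) hcomp_id2 !comp1A.
- rewrite whl_vcomp -[RHS]vcomp_id2 ?src_id2 ?tgt_id2 // => h.
  apply: eq_vcomp.
  + by rewrite whlr (d_eps HG) hcomp_id2.
  + by rewrite whl_comp (d_pf1 HG) -whl_comp (d_eps HF) hcomp_id2.
- rewrite whl_vcomp -[RHS]vcomp_id2 ?src_id2 ?tgt_id2 // => h.
  apply: eq_vcomp.
  + by rewrite whlr (c_eps HG) hcomp_id2.
  + by rewrite whl_comp (c_pf1 HG) -whl_comp (c_eps HF) hcomp_id2.
Qed.

Local Notation HGF := pf_comp_bounds.

Lemma pf2_comp : pf2 HGF = pf2 HG ∘ pf2 HF.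
Proof. exact: map2_comp. Qed.

Lemma pf3_comp : pf3 HGF = pf3 HG ∘ pf3 HF.
Proof.
apply: pb_ext.
- by rewrite comp1A !p1_pf3 -comp1A p1_pf3 comp1A.
- by rewrite comp1A !p2_pf3 -comp1A p2_pf3 comp1A -pf2_comp.
Qed.

(** G1 x G1 acts on 2-cells componentwise. *)
Lemma pf2_whl (Z : K) (x : cell Z (pb2 C')) y z :
  p1 (pb2 C') ◁ x = y -> p2 (pb2 C') ◁ x = z ->
  p1 (pb2 C'') ◁ (pf2 HG ◁ x) = pf1 G ◁ y /\
  p2 (pb2 C'') ◁ (pf2 HG ◁ x) = pf1 G ◁ z.
Proof. by move=> <- <-; rewrite !whl_comp p1_pf2 p2_pf2. Qed.

(** 1 x mu^GF is compared with its two halves one component at a time: on the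
    first an identity is written as a composite of identities, on the second
    this is the definition of mu^GF. The three lemmas after it follow the same
    pattern. *)
Lemma chain_oneXmu_comp s :
  chain_eq ((mm C'' ◁ oneXmu HGF) :: s)
    ((mm C'' ◁ oneXmu HG) ▷ pf3 HF :: (mm C'' ∘ pf2 HG) ◁ oneXmu HF :: s).
Proof.
have h : src (oneXmu HG ▷ pf3 HF) = tgt (pf2 HG ◁ oneXmu HF).
  by rewrite src_whr tgt_whl src_oneXmu tgt_oneXmu comp1A.
have [e1 e2] := pf2_whl (p1_cpair (pb2 C') (oneXmu_compat HF))
                        (p2_cpair (pb2 C') (oneXmu_compat HF)).
have -> : oneXmu HGF = (oneXmu HG ▷ pf3 HF) ⋅[h] (pf2 HG ◁ oneXmu HF).
  apply: pb_cext; rewrite whl_vcomp.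
  - rewrite p1_cpair -[LHS]vcomp_id2 ?src_id2 ?tgt_id2 // => k.
    apply: eq_vcomp; last by rewrite e1 hcomp_id2 comp1A.
    by rewrite whlr p1_cpair hcomp_id2 -comp1A p1_pf3 comp1A.
  - rewrite p2_cpair /= whr_vcomp; apply: eq_vcomp; last by rewrite e2 whlr.
    by rewrite whlr p2_cpair !whr_comp p2_pf3.
by rewrite whl_vcomp chain_vcomp whlr whl_comp.
Qed.

Lemma chain_muXone_comp s :
  chain_eq ((mm C'' ◁ muXone HGF) :: s)
    ((mm C'' ◁ muXone HG) ▷ pf3 HF :: (mm C'' ∘ pf2 HG) ◁ muXone HF :: s).
Proof.
have h : src (muXone HG ▷ pf3 HF) = tgt (pf2 HG ◁ muXone HF).
  by rewrite src_whr tgt_whl src_muXone tgt_muXone comp1A.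
have [e1 e2] := pf2_whl (p1_cpair (pb2 C') (muXone_compat HF))
                        (p2_cpair (pb2 C') (muXone_compat HF)).
have -> : muXone HGF = (muXone HG ▷ pf3 HF) ⋅[h] (pf2 HG ◁ muXone HF).
  apply: pb_cext; rewrite whl_vcomp.
  - rewrite p1_cpair /= whr_vcomp; apply: eq_vcomp; last by rewrite e1 whlr.
    by rewrite whlr p1_cpair !whr_comp pf3_init.
  - rewrite p2_cpair -[LHS]vcomp_id2 ?src_id2 ?tgt_id2 // => k.
    apply: eq_vcomp; last by rewrite e2 hcomp_id2 comp1A.
    rewrite whlr p2_cpair hcomp_id2 -comp1A /pi33 -(comp1A _ _ (pf3 HF)).
    by rewrite p2_pf3 !comp1A -(comp1A _ _ (pf2 HF)) p2_pf2 !comp1A.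
by rewrite whl_vcomp chain_vcomp whlr whl_comp.
Qed.

Lemma chain_one_epsd_comp s :
  chain_eq ((mm C'' ◁ one_epsd HGF) :: s)
    ((mm C'' ◁ one_epsd HG) ▷ pf1 F :: (mm C'' ∘ pf2 HG) ◁ one_epsd HF :: s).
Proof.
have h : src (one_epsd HG ▷ pf1 F) = tgt (pf2 HG ◁ one_epsd HF).
  by rewrite src_whr tgt_whl src_one_epsd tgt_one_epsd comp1A.
have [e1 e2] := pf2_whl (p1_cpair (pb2 C') (one_epsd_compat HF))
                        (p2_cpair (pb2 C') (one_epsd_compat HF)).
have -> : one_epsd HGF = (one_epsd HG ▷ pf1 F) ⋅[h] (pf2 HG ◁ one_epsd HF).
  apply: pb_cext; rewrite whl_vcomp.
  - rewrite p1_cpair -[LHS]vcomp_id2 ?src_id2 ?tgt_id2 // => k.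
    apply: eq_vcomp; last by rewrite e1 hcomp_id2.
    by rewrite whlr p1_cpair hcomp_id2.
  - rewrite p2_cpair /= whr_vcomp; apply: eq_vcomp; last by rewrite e2 whlr.
    by rewrite whlr p2_cpair !whr_comp (d_pf1 HF).
by rewrite whl_vcomp chain_vcomp whlr whl_comp.
Qed.

Lemma chain_epsc_one_comp s :
  chain_eq ((mm C'' ◁ epsc_one HGF) :: s)
    ((mm C'' ◁ epsc_one HG) ▷ pf1 F :: (mm C'' ∘ pf2 HG) ◁ epsc_one HF :: s).
Proof.
have h : src (epsc_one HG ▷ pf1 F) = tgt (pf2 HG ◁ epsc_one HF).
  by rewrite src_whr tgt_whl src_epsc_one tgt_epsc_one comp1A.
have [e1 e2] := pf2_whl (p1_cpair (pb2 C') (epsc_one_compat HF))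
                        (p2_cpair (pb2 C') (epsc_one_compat HF)).
have -> : epsc_one HGF = (epsc_one HG ▷ pf1 F) ⋅[h] (pf2 HG ◁ epsc_one HF).
  apply: pb_cext; rewrite whl_vcomp.
  - rewrite p1_cpair /= whr_vcomp; apply: eq_vcomp; last by rewrite e1 whlr.
    by rewrite whlr p1_cpair !whr_comp (c_pf1 HF).
  - rewrite p2_cpair -[LHS]vcomp_id2 ?src_id2 ?tgt_id2 // => k.
    apply: eq_vcomp; last by rewrite e2 hcomp_id2.
    by rewrite whlr p2_cpair hcomp_id2.
by rewrite whl_vcomp chain_vcomp whlr whl_comp.
Qed.

Lemma chain_mu_comp (Z : K) (f : hom Z (pb2 C)) s :
  chain_eq ((mu GF ▷ f) :: s)
    (mu G ▷ (pf2 HF ∘ f) :: (pf1 G ◁ (mu F ▷ f)) :: s).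
Proof. by rewrite /= whr_vcomp chain_vcomp whr_comp whlr. Qed.

(** Naturality of mu^G with respect to the 2-cell [x]. *)
Lemma chain_slide_mu (Z : K) (x : cell Z (pb2 C')) f f' s :
  src x = f -> tgt x = f' ->
  chain_eq ((mm C'' ∘ pf2 HG) ◁ x :: mu G ▷ f :: s)
    (mu G ▷ f' :: pf1 G ◁ (mm C' ◁ x) :: s).
Proof.
by move=> sx tx; rewrite (chain_slide _ (src_mu HG) (tgt_mu HG) sx tx) whl_comp.
Qed.

Lemma pf_comp_assoc s :
  chain_eq
    (alpha C'' ▷ pf3 HGF :: mm C'' ◁ oneXmu HGF :: mu GF ▷ oneXm C :: s)
    (mm C'' ◁ muXone HGF :: mu GF ▷ mXone C :: pf1 GF ◁ alpha C :: s).
Proof.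
have assocF :=
  chain_eq_whl3 (pf1 G) (pf_assoc (pf_coherenceP (pseudofunctorP F))).
have assocG :=
  chain_eq_whr3 (pf3 HF) (pf_assoc (pf_coherenceP (pseudofunctorP G))).
rewrite pf3_comp -whr_comp chain_oneXmu_comp chain_muXone_comp !chain_mu_comp.
(* The swap puts the cells of G, all whiskered by F, in front. *)
rewrite (chain_slide_mu _ (src_oneXmu HF) (tgt_oneXmu HF)) -whr_comp assocG.
(* The axiom of G has produced G1 alpha' F, the missing first cell of F. *)
rewrite -(whlr _ (alpha C')) assocF.
by rewrite (chain_slide_mu _ (src_muXone HF) (tgt_muXone HF)) -whr_comp -whl_comp.
Qed.

(** After the swap on the right-hand side, G1 F1 rho is expanded by the axiom
    of F, which produces G1 rho' F, and this factor by the axiom of G. *)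
Lemma pf_comp_rho s :
  chain_eq (pf1 GF ◁ rho C :: s)
    (rho C'' ▷ pf1 GF :: mm C'' ◁ one_epsd HGF :: mu GF ▷ one_ed C :: s).
Proof.
rewrite chain_one_epsd_comp chain_mu_comp.
rewrite (chain_slide_mu _ (src_one_epsd HF) (tgt_one_epsd HF)) /=.
rewrite -whl_comp (pf_rho (pf_coherenceP (pseudofunctorP F))) !chain_whl.
rewrite whlr (pf_rho (pf_coherenceP (pseudofunctorP G))).
by rewrite !chain_whr !whr_comp.
Qed.

Lemma pf_comp_lambda s :
  chain_eq (pf1 GF ◁ lambda C :: s)
    (lambda C'' ▷ pf1 GF :: mm C'' ◁ epsc_one HGF :: mu GF ▷ ec_1 C :: s).
Proof.
rewrite chain_epsc_one_comp chain_mu_comp.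
rewrite (chain_slide_mu _ (src_epsc_one HF) (tgt_epsc_one HF)) /=.
rewrite -whl_comp (pf_lambda (pf_coherenceP (pseudofunctorP F))) !chain_whl.
rewrite whlr (pf_lambda (pf_coherenceP (pseudofunctorP G))).
by rewrite !chain_whr !whr_comp.
Qed.

End Composite.

Theorem proposition1 (K : twocat) (C C' C'' : pseudocat K)
  (F : pseudofunctor C C') (G : pseudofunctor C' C'') :
  is_pseudofunctor (pf_comp F G).
Proof.
exists (pf_comp_bounds F G).
split; apply: chain_eq_inj; rewrite !chain_vcomp.
- exact: pf_comp_assoc.
- exact: pf_comp_rho.
- exact: pf_comp_lambda.
Qed.
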